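(* Let $S_1$ and $S_2$ be two isometries such that $S_1S_1^*+S_2S_2^*=1$, and let $\sigma$ be the unique order two automorphism of $\mathcal{O}_2=C^*(S_1,S_2)$ such that $\sigma(S_1)=S_2$. Let $$T=\frac{1}{\sqrt{2}}(S_1+S_2),\qquad U=S_1S_1^*-S_2S_2^*,\qquad V=UTU=\frac{1}{\sqrt{2}}(S_1-S_2)(S_1S_1^*-S_2S_2^* ).$$ Then the fixed point C*-algebra $[\mathcal{O}_2]_1=\{a\in\mathcal{O}_2:\sigma(a)=a\}$ is $C^*(T,V)$, and it is *-isomorphic to $\mathcal{O}_2$.
   Context: The Cuntz algebra $\mathcal{O}_2$ is the universal unital C*-algebra generated by two isometries $S_1,S_2$ (i.e. $S_1^*S_1=S_2^*S_2=1$) with $S_1S_1^*+S_2S_2^*=1$. It is simple, and for any two isometries satisfying this relation on a nonzero Hilbert space, the C*-algebra $C^*(S_1,S_2)$ they generate is (canonically) $\mathcal{O}_2$. By universality there is a unique *-automorphism $\sigma$ of $\mathcal{O}_2$ with $\sigma(S_1)=S_2$ and $\sigma(S_2)=S_1$; it satisfies $\sigma^2=\mathrm{id}$. $C^*(X_1,\dots,X_n)$ denotes the C*-algebra generated by $X_1,\dots,X_n$. *)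

(* Defs.v *)
From HB Require Import structures.
From mathcomp Require Import all_boot all_order all_algebra.
From mathcomp Require Import complex.
From mathcomp Require Import all_classical all_reals all_analysis.

Set Implicit Arguments.
Unset Strict Implicit.
Unset Printing Implicit Defensive.

Import Order.TTheory GRing.Theory Num.Theory.
Import numFieldNormedType.Exports.

Local Open Scope classical_set_scope.
Local Open Scope complex_scope.
Local Open Scope ring_scope.

Section operators_on_a_Hilbert_space.
Context (R : realType) (H : completeNormedModType R[i]).

(* The inner product is linear in the first argument, conjugate-linear in the
   second.  A Hilbert space is a complete normed space H together with a form
   [dot] such that [hilbert_norm dot]. *)
Definition hilbert_norm (dot : {dot H for (@Num.conj R[i])}) : Prop :=
  forall x : H, `|x| ^+ 2 = dot x x.

Implicit Types (dot : {dot H for (@Num.conj R[i])}) (a b : H -> H).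

(* [opnorm_le a r] says that the operator norm of a is at most r.  The norm of H
   takes its values in R[i], where [0 <= r] forces r to be real. *)
Definition opnorm_le a (r : R[i]) : Prop := forall x : H, `|a x| <= r * `|x|.

Definition bounded_operator : set (H -> H) :=
  [set a | linear a /\ exists r : R[i], opnorm_le a r].

Definition is_adjoint dot a b : Prop :=
  forall x y : H, dot (a x) y = dot x (b y).

(* On a Hilbert space every bounded operator has exactly one adjoint (Riesz), so
   the default value 0 is never used for the operators considered. *)
Definition adjoint dot a : H -> H := xget (0 : H -> H) [set b | is_adjoint dot a b].

(* C*-algebras of operators on H: norm-closed *-subalgebras of B(H), not
   required to contain the identity operator. *)
Record cstar_subalgebra dot (A : set (H -> H)) : Prop := CstarSubalgebra {
  cstar_bounded : A `<=` bounded_operator;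
  cstar_zero : A 0;
  cstar_add : forall a b, A a -> A b -> A (a + b);
  cstar_scale : forall (c : R[i]) a, A a -> A (c *: a);
  cstar_mul : forall a b, A a -> A b -> A (a \o b);
  cstar_adj : forall a, A a -> A (adjoint dot a);
  cstar_closed : forall a, bounded_operator a ->
    (forall e : R[i], 0 < e -> exists2 b, A b & opnorm_le (a - b) e) -> A a
}.

(* C*(G) *)
Definition cstar_generated dot (G : set (H -> H)) : set (H -> H) :=
  smallest (cstar_subalgebra dot) G.

(* Only the values of f on A matter. *)
Record star_isomorphism dot (A B : set (H -> H)) (f : (H -> H) -> (H -> H)) :
    Prop := StarIsomorphism {
  star_bij : set_bij A B f;
  star_add : forall a b, A a -> A b -> f (a + b) = f a + f b;
  star_scale : forall (c : R[i]) a, A a -> f (c *: a) = c *: f a;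
  star_mul : forall a b, A a -> A b -> f (a \o b) = f a \o f b;
  star_adj : forall a, A a -> f (adjoint dot a) = adjoint dot (f a)
}.

Definition star_automorphism dot (A : set (H -> H)) :=
  star_isomorphism dot A A.

Definition star_isomorphic dot (A B : set (H -> H)) : Prop :=
  exists f, star_isomorphism dot A B f.

Definition isometry_operator dot a : Prop :=
  bounded_operator a /\ adjoint dot a \o a = idfun.

End operators_on_a_Hilbert_space.

(* Main.v *)
Require Import Defs.
From HB Require Import structures.
From mathcomp Require Import all_boot all_order all_algebra.
From mathcomp Require Import complex.
From mathcomp Require Import all_classical all_reals all_analysis.
From mathcomp Require Import ring zify.

Import Order.TTheory GRing.Theory Num.Theory.
Import numFieldNormedType.Exports.

Local Open Scope classical_set_scope.
Local Open Scope complex_scope.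
Local Open Scope ring_scope.

Set Implicit Arguments.
Unset Strict Implicit.
Unset Printing Implicit Defensive.

(** Why the theorem is true.  The operators T and V satisfy the Cuntz relations:
    both are isometries and their ranges are orthogonal with sum H.  The symmetry
    U is a self-adjoint unitary with U T U = V and U V U = T, so conjugation by U
    preserves D = C*(T, V), and S1, S2 = (T +- V U) / sqrt 2.  Hence every element
    of C*(S1, S2) is b + c U with b and c in D (cuntz_decomposition).  The flip
    sigma fixes T and V and sends U to - U, so sigma (b + c U) = b - c U, and
    b + c U is fixed exactly when it equals b.  That gives fixed = D.

    It remains to see that the C*-algebras of two Cuntz pairs S and T on the same
    nonzero space are isomorphic.  This is proved directly, by showing that
    ||p(T)|| <= ||p(S)|| for every *-polynomial p (cuntz_opnorm_le).  Let Q be an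
    operator, and put J_0 = Q, J_(m+1) = sum_i S_i J_m T_i'; these intertwine
    the two pairs: S_i J_m = J_(m+1) T_i and S_i' J_(m+1) = J_m T_i'.  Therefore
    p(S) J_(m+d) is a sum of terms J_(m+k) c, where the operators c add up to p(T).
    If Q = S_1^M S_2, then J_0, ..., J_M are isometries with pairwise orthogonal
    ranges.  Averaging over a long window of indices m, the vector
    eta = sum_m J_(m+d) x is mapped by p(S) to a vector that agrees with
    sum_l J_l (p(T) x) except near the two ends of the window, and comparison of
    norms gives the inequality as the window grows.  Exchanging the roles of S and
    T, the correspondence p(S) <-> p(T) is isometric and extends to the closures
    (peval_closure_isomorphic).

    The automorphism sigma is only assumed to be algebraic.  Its continuity
    comes from positivity: if ||a|| <= 1/2, then 1 - a' a = c c for a self-adjoint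
    c in the algebra, so 1 - sigma(a)' sigma(a) is also the square of a
    self-adjoint operator and ||sigma(a)|| <= 1 (star_isomorphism_continuous).

    Throughout, a prime marks an adjoint. *)

(** * Operators on a Hilbert space *)
Section operators.
Context (R : realType) (H : completeNormedModType R[i]).
Variable dot : {dot H for (@Num.conj R[i])}.
Hypothesis hH : hilbert_norm dot.
Hypothesis H_nonzero : exists x : H, x != 0.
Implicit Types (a b c : H -> H) (r s e : R[i]) (x y z : H).

(** Operators are plain functions with a linearity hypothesis; packing them lets
    the library lemmas on linear maps apply. *)
Lemma linear_pack a : linear a -> exists f : {linear H -> H}, a = f.
Proof.
move=> h.
by exists (HB.pack_for {linear H -> H} a (GRing.isLinear.Build _ _ _ _ a h)).
Qed.

Lemma linear_operatorD a x y : linear a -> a (x + y) = a x + a y.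
Proof. by move=> /linear_pack[f ->]; rewrite linearD. Qed.

Lemma linear_operatorB a x y : linear a -> a (x - y) = a x - a y.
Proof. by move=> /linear_pack[f ->]; rewrite linearB. Qed.

Lemma linear_operatorZ a (k : R[i]) x : linear a -> a (k *: x) = k *: a x.
Proof. by move=> /linear_pack[f ->]; rewrite linearZ. Qed.

Lemma linear_operatorN a x : linear a -> a (- x) = - a x.
Proof. by move=> /linear_pack[f ->]; rewrite linearN. Qed.

Lemma linear_operator0 a : linear a -> a 0 = 0.
Proof. by move=> /linear_pack[f ->]; rewrite linear0. Qed.

Lemma linear_operator_sum a I (s : seq I) (P : pred I) (F : I -> H) :
  linear a -> a (\sum_(i <- s | P i) F i) = \sum_(i <- s | P i) a (F i).
Proof. by move=> /linear_pack[f ->]; rewrite linear_sum. Qed.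

Lemma dotC x y : dot x y = (dot y x)^*.
Proof. by rewrite hermC expr0 mul1r. Qed.

Lemma dotZl (k : R[i]) x y : dot (k *: x) y = k * dot x y.
Proof. by rewrite linearZl_LR. Qed.

Lemma dotZr (k : R[i]) x y : dot x (k *: y) = k^* * dot x y.
Proof. by rewrite linearZr_LR. Qed.

Lemma dot_ext x y : (forall z, dot z x = dot z y) -> x = y.
Proof.
move=> h; apply/subr0_eq/eqP; rewrite -normr_eq0 -sqrf_eq0 hH.
by rewrite linearBr/= h subrr.
Qed.

Lemma CauchySchwarz_hilbert x y : `|dot x y| <= `|x| * `|y|.
Proof.
have [->|y0] := eqVneq y 0; first by rewrite linear0r !normr0 mulr0.
have ny : 0 < `|y| ^+ 2 by rewrite exprn_gt0// normr_gt0.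
rewrite -(ler_pXn2r (n := 2)) ?nnegrE ?mulr_ge0 ?normr_ge0//.
rewrite exprMn.
(* t y is the orthogonal projection of x on the line of y. *)
pose t := dot x y / `|y| ^+ 2.
have : 0 <= dot (x - t *: y) (x - t *: y) by rewrite -hH exprn_ge0.
rewrite linearBl !linearBr/= !dotZl !dotZr -!hH.
rewrite (dotC y x) /t.
have Ey : (`|y| ^+ 2)^* = `|y| ^+ 2 :> R[i].
  by rewrite hH -dotC.
rewrite !rmorphM/= fmorphV/= Ey.
set d := dot x y; set n := `|y| ^+ 2 in ny *.
have -> : `|x| ^+ 2 - d^* / n * d - (d / n * d^* - d / n * (d^* / n * n)) =
  `|x| ^+ 2 - (d * d^*) / n.
  by field; rewrite gt_eqF.
by rewrite -normCK subr_ge0 ler_pdivrMr.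
Qed.

(** On the zero space every r would be a bound. *)
Lemma opnorm_le_ge0 a r : opnorm_le a r -> 0 <= r.
Proof.
case: H_nonzero => x x0 /(_ x) h.
have nx : 0 < `|x| by rewrite normr_gt0.
by rewrite -(pmulr_lge0 _ nx); apply: le_trans h; exact: normr_ge0.
Qed.

Lemma opnorm_leW a r s : r <= s -> opnorm_le a r -> opnorm_le a s.
Proof. by move=> rs h x; apply: le_trans (h x) _; exact: ler_wpM2r. Qed.

Lemma opnorm_leD a b r s :
  opnorm_le a r -> opnorm_le b s -> opnorm_le (a + b) (r + s).
Proof.
move=> ha hb x; rewrite mulrDl.
by apply: le_trans (ler_normD _ _) _; exact: lerD.
Qed.

Lemma opnorm_leN a r : opnorm_le a r -> opnorm_le (- a) r.
Proof. by move=> ha x; rewrite -[_ x]/(- a x) normrN. Qed.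

Lemma opnorm_le_0 r : 0 <= r -> opnorm_le (0 : H -> H) r.
Proof. by move=> r0 x; rewrite normr0 mulr_ge0. Qed.

Lemma opnorm_leBC a b r : opnorm_le (a - b) r -> opnorm_le (b - a) r.
Proof. by move=> /opnorm_leN; rewrite opprB. Qed.

Lemma opnorm_leZ (k : R[i]) a r :
  opnorm_le a r -> opnorm_le (k *: a) (`|k| * r).
Proof.
by move=> ha x; rewrite -[_ x]/(k *: a x) normrZ -mulrA ler_wpM2l.
Qed.

Lemma opnorm_leM a b r s :
  opnorm_le a r -> opnorm_le b s -> opnorm_le (a \o b) (r * s).
Proof.
move=> ha hb x; rewrite -mulrA; apply: le_trans (ha _) _.
exact/ler_wpM2l/hb/(opnorm_le_ge0 ha).
Qed.

Lemma opnorm_le_lim a r :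
  (forall e, 0 < e -> opnorm_le a (r + e)) -> opnorm_le a r.
Proof.
move=> h x.
have [->|x0] := eqVneq x 0.
  have /(_ 0) := h 1 ltr01.
  by rewrite !normr0 !mulr0.
have nx : 0 < `|x| by rewrite normr_gt0.
rewrite -ler_pdivrMr//; apply/ler_addgt0Pr => e e0.
by rewrite ler_pdivrMr//; exact: h.
Qed.

Lemma opnorm_le_small a b :
  (forall e, 0 < e -> opnorm_le (a - b) e) -> a = b.
Proof.
move=> h; apply/funext => x; apply/subr0_eq/eqP; rewrite -normr_le0.
have : opnorm_le (a - b) 0 by apply: opnorm_le_lim => e e0; rewrite add0r; exact: h.
by move=> /(_ x); rewrite mul0r.
Qed.

Lemma bounded_linear a : bounded_operator a -> linear a.
Proof. by case. Qed.

Lemma bounded0 : bounded_operator (0 : H -> H).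
Proof.
split; first by move=> k x y /=; rewrite -![GRing.zero _]/(0 : H) scaler0 addr0.
by exists 0 => x; rewrite normr0 mul0r.
Qed.

Lemma boundedD a b :
  bounded_operator a -> bounded_operator b -> bounded_operator (a + b).
Proof.
move=> [la [r ar]] [lb [s bs]]; split; last by exists (r + s); exact: opnorm_leD.
by move=> k x y; rewrite !fctE la lb scalerDr addrACA.
Qed.

Lemma boundedZ (k : R[i]) a : bounded_operator a -> bounded_operator (k *: a).
Proof.
move=> [la [r ar]]; split; last by exists (`|k| * r); exact: opnorm_leZ.
by move=> l x y; rewrite !fctE la scalerDr !scalerA mulrC.
Qed.

Lemma boundedB a b :
  bounded_operator a -> bounded_operator b -> bounded_operator (a - b).
Proof.
by move=> ha hb; rewrite -scaleN1r; apply: boundedD => //; exact: boundedZ.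
Qed.

Lemma boundedM a b :
  bounded_operator a -> bounded_operator b -> bounded_operator (a \o b).
Proof.
move=> [la [r ar]] [lb [s bs]]; split; last by exists (r * s); exact: opnorm_leM.
by move=> k x y /=; rewrite lb la.
Qed.

(** A positive element of R[i] is real, so the archimedean property of R applies. *)
Lemma complex_archi e : 0 < e -> exists n : nat, n.+1%:R^-1 < e.
Proof.
move=> e0; have re : 0 < complex.Re e by move: e0; rewrite ltcE => /andP[].
have [n hn] := ltr_add_invr re.
exists n; have : (complex.Re e)%:C = e by rewrite RRe_real// gtr0_real.
move=> <-.
have -> : n.+1%:R^-1 = (n.+1%:R^-1)%:C :> R[i] by rewrite fmorphV/= rmorph_nat.
by rewrite ltcR -[ltLHS]add0r.
Qed.

(** The space of bounded operators is complete for the operator norm: a Cauchy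
    sequence converges pointwise, and the estimates pass to the pointwise limit. *)
Lemma operators_complete (u : nat -> H -> H) :
  (forall n, bounded_operator (u n)) ->
  (forall e, 0 < e -> exists N, forall n m, (N <= n)%N -> (N <= m)%N ->
     opnorm_le (u n - u m) e) ->
  exists2 a, bounded_operator a &
    forall e, 0 < e -> exists N, forall n, (N <= n)%N -> opnorm_le (a - u n) e.
Proof.
move=> bu cu.
have cvgu x : cvgn (fun n => u n x).
  apply/cauchy_cvgP/cauchy_ballP => e e0.
  have [N hN] := cu (e / (`|x| + 1)) (divr_gt0 e0 (ltr_pwDr ltr01 (normr_ge0 _))).
  exists ([set u n x | n in [set n | (N <= n)%N]],
          [set u n x | n in [set n | (N <= n)%N]]).
    by split; exists N => // n Nn; exists n.
  move=> [_ _] /= [[n Nn <-] [m Nm <-]].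
  rewrite -ball_normE /=; apply: le_lt_trans (hN n m Nn Nm x) _.
  by rewrite mulrAC ltr_pdivrMr ?ltr_pwDr// ltr_pM2l// ltrDl.
pose a x := limn (fun n => u n x).
have ca x : (fun n => u n x) @ \oo --> a x by exact: cvgu.
have la : linear a.
  move=> k x y; apply: cvg_lim => //.
  have -> : (fun n => u n (k *: x + y)) = (fun n => k *: u n x + u n y).
    by apply/funext => n; rewrite (bounded_linear (bu n)).
  by apply: cvgD => //; apply: cvgZr.
have au e : 0 < e -> exists N, forall n, (N <= n)%N -> opnorm_le (a - u n) e.
  move=> e0; have [N hN] := cu e e0; exists N => n Nn x.
  apply/ler_addgt0Pr => d d0.
  have /cvgrPdist_lt/(_ d d0)[N' _ hN'] := ca x.
  have am := hN' (maxn N N') (leq_maxr _ _).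
  have mn := hN (maxn N N') n (leq_maxl _ _) Nn x.
  rewrite -[_ x]/(a x - u n x) -(subrK (u (maxn N N') x) (a x)) -addrA addrC.
  by apply: le_trans (ler_normD _ _) _; apply: lerD => //; exact: ltW.
exists a => //; split => //.
have [N hN] := au 1 ltr01; case: (bu N) => _ [r hr]; exists (1 + r).
by rewrite -(subrK (u N) a); apply: opnorm_leD => //; exact: hN.
Qed.

Lemma is_adjoint_sym a b : is_adjoint dot a b -> is_adjoint dot b a.
Proof. by move=> h x y; rewrite dotC -h -dotC. Qed.

Lemma is_adjoint_uniq a b c : is_adjoint dot a b -> is_adjoint dot a c -> b = c.
Proof.
by move=> hb hc; apply/funext => y; apply: dot_ext => z; rewrite -hb hc.
Qed.

Lemma adjointE a b : is_adjoint dot a b -> adjoint dot a = b.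
Proof.
move=> h; apply: xget_unique => // c hc; exact: is_adjoint_uniq hc h.
Qed.

Lemma is_adjoint_linear a b : is_adjoint dot a b -> linear b.
Proof.
move=> h k x y; apply: dot_ext => z.
by rewrite linearDr/= dotZr -!h linearDr/= dotZr.
Qed.

(** From |b y|^2 = <a (b y), y> <= r |b y| |y|. *)
Lemma opnorm_le_adjoint a b r :
  is_adjoint dot a b -> opnorm_le a r -> opnorm_le b r.
Proof.
move=> h ar y; have r0 := opnorm_le_ge0 ar.
have [->|by0] := eqVneq (b y) 0; first by rewrite normr0 mulr_ge0.
have nby : 0 < `|b y| by rewrite normr_gt0.
rewrite -(ler_pM2l nby) -expr2 hH -h.
apply: le_trans (real_ler_norm _) _.
  by rewrite h -hH ger0_real// exprn_ge0.
apply: le_trans (CauchySchwarz_hilbert _ _) _.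
by rewrite mulrA ler_wpM2r// mulrC.
Qed.

Lemma is_adjoint_bounded a b :
  is_adjoint dot a b -> bounded_operator a -> bounded_operator b.
Proof.
move=> h [_ [r ar]]; split; first exact: is_adjoint_linear h.
by exists r; exact: opnorm_le_adjoint ar.
Qed.

Lemma is_adjointD a a' b b' : is_adjoint dot a a' -> is_adjoint dot b b' ->
  is_adjoint dot (a + b) (a' + b').
Proof. by move=> ha hb x y; rewrite !fctE linearDl linearDr/= ha hb. Qed.

Lemma is_adjointZ (k : R[i]) a a' : is_adjoint dot a a' ->
  is_adjoint dot (k *: a) (k^* *: a').
Proof. by move=> ha x y; rewrite !fctE dotZl dotZr ha conjCK. Qed.

Lemma is_adjointB a a' b b' : is_adjoint dot a a' -> is_adjoint dot b b' ->
  is_adjoint dot (a - b) (a' - b').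
Proof. by move=> ha hb x y; rewrite !fctE linearBl linearBr/= ha hb. Qed.

Lemma is_adjointM a a' b b' : is_adjoint dot a a' -> is_adjoint dot b b' ->
  is_adjoint dot (a \o b) (b' \o a').
Proof. by move=> ha hb x y /=; rewrite ha hb. Qed.

(** A norm limit of operators inherits an adjoint as soon as the adjoints converge;
    this yields adjoints in C*(S1, S2) from those of the generators. *)
Lemma is_adjoint_lim a b :
  (forall e, 0 < e -> exists a' b', [/\ is_adjoint dot a' b',
     opnorm_le (a - a') e & opnorm_le (b - b') e]) -> is_adjoint dot a b.
Proof.
move=> h x y; apply/subr0_eq/eqP; rewrite -normr_le0.
apply/ler_addgt0Pr => e e0; rewrite add0r.
(* The two error terms add up to at most twice the tolerance times |x| |y|. *)
pose n := `|x| * `|y| * 2 + 1.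
have n0 : 0 < n by rewrite ltr_pwDr// !mulr_ge0.
have [a' [b' [ab' aa' bb']]] := h (e / n) (divr_gt0 e0 n0).
have -> : dot (a x) y - dot x (b y) = dot ((a - a') x) y - dot x ((b - b') y).
  by rewrite !fctE linearBl linearBr/= ab' opprB addrA subrK.
apply: le_trans (ler_normB _ _) _.
have e1 : `|dot ((a - a') x) y| <= e / n * `|x| * `|y|.
  by apply: le_trans (CauchySchwarz_hilbert _ _) _; rewrite ler_wpM2r.
have e2 : `|dot x ((b - b') y)| <= `|x| * (e / n * `|y|).
  by apply: le_trans (CauchySchwarz_hilbert _ _) _; rewrite ler_wpM2l.
apply: le_trans (lerD e1 e2) _.
have -> : e / n * `|x| * `|y| + `|x| * (e / n * `|y|) = e / n * (n - 1).
  by rewrite /n addrK; ring.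
rewrite mulrAC ler_pdivrMr//; apply: ler_wpM2l; first exact: ltW.
by rewrite gerBl.
Qed.

(** * Cuntz families and their *-polynomials *)

(** A Cuntz pair indexed by bool, with the adjoints as data: the relations can then
    be used as rewriting rules, without reference to the choice of an adjoint. *)
Record cuntz_family (S S' : bool -> H -> H) : Prop := CuntzFamily {
  cuntz_linear : forall i, linear (S i);
  cuntz_adjoint : forall i, is_adjoint dot (S i) (S' i);
  cuntz_orth : forall i j x, S' i (S j x) = if i == j then x else 0;
  cuntz_sum : forall x, \sum_(i : bool) S i (S' i x) = x }.

(** Formal *-polynomials.  Keeping them formal is what allows one polynomial to be
    evaluated at two different pairs. *)
Inductive star_poly : Type :=
  | PGen of bool
  | PAdj of bool
  | PAdd of star_poly & star_poly
  | PScale of R[i] & star_poly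
  | PMul of star_poly & star_poly.

Fixpoint peval (S S' : bool -> H -> H) (p : star_poly) : H -> H :=
  match p with
  | PGen i => S i
  | PAdj i => S' i
  | PAdd p q => peval S S' p + peval S S' q
  | PScale k p => k *: peval S S' p
  | PMul p q => peval S S' p \o peval S S' q
  end.

Fixpoint pstar (p : star_poly) : star_poly :=
  match p with
  | PGen i => PAdj i
  | PAdj i => PGen i
  | PAdd p q => PAdd (pstar p) (pstar q)
  | PScale k p => PScale k^* (pstar p)
  | PMul p q => PMul (pstar q) (pstar p)
  end.

Section one_family.
Variables (S S' : bool -> H -> H).
Hypothesis hS : cuntz_family S S'.

Lemma cuntz_adjoint_linear i : linear (S' i).
Proof. exact: is_adjoint_linear (cuntz_adjoint hS i). Qed.

Lemma cuntz_dot i j x y : dot (S i x) (S j y) = if i == j then dot x y else 0.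
Proof.
rewrite (cuntz_adjoint hS) (cuntz_orth hS).
by case: eqP => // _; rewrite linear0r.
Qed.

Lemma cuntz_dot_sum x y : \sum_(i : bool) dot (S' i x) (S' i y) = dot x y.
Proof.
rewrite -[in RHS](cuntz_sum hS y) linear_sumr/=; apply: eq_bigr => i _.
by rewrite -(is_adjoint_sym (cuntz_adjoint hS i)).
Qed.

Lemma cuntz_bounded i : bounded_operator (S i).
Proof.
split; first exact: cuntz_linear hS i.
exists 1 => x; rewrite mul1r -(ler_pXn2r (n := 2)) ?nnegrE//.
by rewrite !hH cuntz_dot eqxx.
Qed.

Lemma cuntz_adjoint_bounded i : bounded_operator (S' i).
Proof. exact: is_adjoint_bounded (cuntz_adjoint hS i) (cuntz_bounded i). Qed.

Lemma peval_bounded p : bounded_operator (peval S S' p).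
Proof.
elim: p => [i|i|p hp q hq|k p hp|p hp q hq] /=.
- exact: cuntz_bounded.
- exact: cuntz_adjoint_bounded.
- exact: boundedD.
- exact: boundedZ.
- exact: boundedM.
Qed.

Lemma peval_adjoint p : is_adjoint dot (peval S S' p) (peval S S' (pstar p)).
Proof.
elim: p => [i|i|p hp q hq|k p hp|p hp q hq] /=.
- exact: cuntz_adjoint hS i.
- exact/is_adjoint_sym/(cuntz_adjoint hS i).
- exact: is_adjointD.
- exact: is_adjointZ.
- exact: is_adjointM.
Qed.

(** The operator S_true^M S_false.  Its range Y has the property that S_w Y is
    orthogonal to Y for every nonempty word w of length at most M: either w is not
    a power of true, and S_w Y and Y lie in the ranges of two different words of
    the same length, or w is such a power and the letter false occurs in different
    places. *)
Definition separator (M : nat) x := iter M (S true) (S false x).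

Lemma dot_iter_isometry M x y :
  dot (iter M (S true) x) (iter M (S true) y) = dot x y.
Proof. by elim: M => //= M IH; rewrite cuntz_dot eqxx. Qed.

End one_family.

(** * Comparison of two Cuntz families *)
Section two_families.
Variables (S S' T T' : bool -> H -> H).
Hypotheses (hS : cuntz_family S S') (hT : cuntz_family T T').

(** The sum of S_w Q T_w' over the words w of length m: it reads off the first m
    letters of a vector in the family T, writes them in the family S, and applies Q
    to what is left. *)
Fixpoint transport (Q : H -> H) m x :=
  if m is m'.+1 then \sum_(i : bool) S i (transport Q m' (T' i x)) else Q x.

Lemma transport_linear Q m : linear Q -> linear (transport Q m).
Proof.
move=> lQ; elim: m => //= m IH k x y.
rewrite scaler_sumr -big_split/=; apply: eq_bigr => i _.
by rewrite (cuntz_adjoint_linear hT) IH (cuntz_linear hS).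
Qed.

Lemma transport_gen Q m i x : linear Q ->
  transport Q m.+1 (T i x) = S i (transport Q m x).
Proof.
move=> lQ; rewrite /= (bigD1 i)//= (cuntz_orth hT) eqxx big1 ?addr0//.
move=> j ji; rewrite (cuntz_orth hT) (negbTE ji).
rewrite (linear_operator0 (transport_linear m lQ)).
exact: linear_operator0 (cuntz_linear hS j).
Qed.

Lemma transport_adj Q m i x :
  S' i (transport Q m.+1 x) = transport Q m (T' i x).
Proof.
rewrite /= (linear_operator_sum _ _ _ (cuntz_adjoint_linear hS i)).
rewrite (bigD1 i)//= (cuntz_orth hS) eqxx big1 ?addr0//.
by move=> j ji; rewrite (cuntz_orth hS) eq_sym (negbTE ji).
Qed.

Lemma dot_transport_step Q m l x y :
  dot (transport Q m.+1 x) (transport Q l.+1 y) =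
  \sum_(i : bool) dot (transport Q m (T' i x)) (transport Q l (T' i y)).
Proof.
rewrite [transport Q l.+1 y]/= linear_sumr/=; apply: eq_bigr => i _.
rewrite -(is_adjoint_sym (cuntz_adjoint hS i)).
by rewrite [in LHS]transport_adj.
Qed.

(** Peeling off m letters leaves S_true^m S_false against S_false, hence 0. *)
Lemma dot_transport_separator M m x y : (0 < m <= M)%N ->
  dot (transport (separator S M) m x) (separator S M y) = 0.
Proof.
move=> /andP[m0 mM].
have step k z u : dot (transport (separator S M) k z) (iter k (S true) u) =
    dot (separator S M (iter k (T' true) z)) u.
  elim: k z => //= k IH z.
  rewrite -[\sum_i _]/(transport (separator S M) k.+1 z).
  rewrite -(is_adjoint_sym (cuntz_adjoint hS true)) transport_adj IH.
  by rewrite -iterS iterSr.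
rewrite [separator S M y]/separator -{2}(subnKC mM) iterD step /separator.
rewrite -{1}(subnK mM) iterD (dot_iter_isometry hS).
by case: m m0 {mM step} => // m _; rewrite iterS (cuntz_dot hS).
Qed.

(** For Q = S_true^M S_false the operators J_0, ..., J_M are isometries with
    pairwise orthogonal ranges: stepping down reduces to the case where one index
    is 0. *)
Lemma dot_transport M m l x y : (m <= M)%N -> (l <= M)%N ->
  dot (transport (separator S M) m x) (transport (separator S M) l y) =
  if m == l then dot x y else 0.
Proof.
elim: m l x y => [|m IH] [|l] x y mM lM.
- by rewrite /= (dot_iter_isometry hS) (cuntz_dot hS) eqxx.
- by rewrite dotC dot_transport_separator ?rmorph0.
- by rewrite dot_transport_separator.
rewrite dot_transport_step eqSS.
under eq_bigr do rewrite IH ?(ltnW mM) ?(ltnW lM)//.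
case: eqP => _; first exact: cuntz_dot_sum hT _ _.
by rewrite big1.
Qed.

(** The list s decomposes p into homogeneous components, with the degrees shifted by
    d to be natural numbers.  It is essential that d and s do not depend on Q, since
    Q is chosen later in terms of the size of the degrees. *)
Lemma transport_intertwines p :
  exists (d : nat) (s : seq (nat * (H -> H))),
    (forall x, peval T T' p x = \sum_(w <- s) w.2 x) /\
    forall Q m x, linear Q -> peval S S' p (transport Q (m + d) x) =
      \sum_(w <- s) transport Q (m + w.1) (w.2 x).
Proof.
elim: p => [i|i|p [d [s [es hs]]] q [d' [s' [es' hs']]]
           |k p [d [s [es hs]]]|p [d [s [es hs]]] q [d' [s' [es' hs']]]] /=.
- exists 0%N, [:: (1%N, T i)]; split=> [x|Q m x lQ]; first by rewrite big_seq1.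
  by rewrite big_seq1 addn0 addn1 transport_gen.
- exists 1%N, [:: (0%N, T' i)]; split=> [x|Q m x lQ]; first by rewrite big_seq1.
  by rewrite big_seq1 addn0 addn1 transport_adj.
- exists (d + d')%N, ([seq ((w.1 + d')%N, w.2) | w <- s] ++
                      [seq ((w.1 + d)%N, w.2) | w <- s']).
  split=> [x|Q m x lQ]; first by rewrite big_cat !big_map !fctE es es'.
  rewrite big_cat !big_map fctE.
  rewrite {1}(addnC d d') addnA hs// (addnA m d d') hs'//.
  by congr (_ + _); apply: eq_bigr => w _; rewrite -addnA (addnC w.1)// addnA.
- exists d, [seq (w.1, k *: w.2) | w <- s].
  split=> [x|Q m x lQ]; rewrite big_map fctE ?es ?hs// scaler_sumr//.
  by apply: eq_bigr => w _; rewrite (linear_operatorZ _ _ (transport_linear _ lQ)).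
- have lp := bounded_linear (peval_bounded hS p).
  have lp' := bounded_linear (peval_bounded hT p).
  exists (d + d')%N, [seq ((w.1 + w'.1)%N, w.2 \o w'.2) | w' <- s', w <- s].
  split=> [x|Q m x lQ]; rewrite big_allpairs_dep/=.
    rewrite es' (linear_operator_sum _ _ _ lp'); apply: eq_bigr => w' _.
    by rewrite es.
  rewrite addnA hs'// (linear_operator_sum _ _ _ lp); apply: eq_bigr => w' _.
  rewrite addnAC hs//; apply: eq_bigr => w _.
  by rewrite -addnA (addnC w'.1).
Qed.

Lemma dot_sum_transport M N k l x y : (N + k <= M.+1)%N -> (l <= M)%N ->
  dot (\sum_(m < N) transport (separator S M) (m + k) x)
      (transport (separator S M) l y) =
  if (k <= l < N + k)%N then dot x y else 0.
Proof.
move=> NM lM; rewrite linear_sumlz/=.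
under eq_bigr => m _.
  rewrite dot_transport//; last by rewrite -ltnS (leq_trans _ NM)// ltn_add2r.
  over.
case: ifPn => [/andP[kl lN]|kl].
  have lk : (l - k < N)%N by rewrite ltn_subLR// addnC.
  rewrite (bigD1 (Ordinal lk))//= subnK// eqxx big1 ?addr0// => m mk.
  by case: eqP => // ml; case/eqP: mk; apply/val_inj; rewrite /= -ml addnK.
rewrite big1// => m _; case: eqP => // ml; move: kl.
by rewrite -ml leq_addl ltn_add2r ltn_ord.
Qed.

(** The boundary effect K is negligible against a long window n. *)
Lemma ler_of_natmul_bound (u v : R[i]) (K : nat) : 0 <= v ->
  (forall n : nat, n%:R * u <= (n + K)%:R * v) -> u <= v.
Proof.
move=> v0 h; apply/ler_addgt0Pr => e e0.
have Kv : 0 < K%:R * v + 1 by rewrite ltr_wpDl// mulr_ge0.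
have [n hn] := complex_archi (divr_gt0 e0 Kv).
have n0 : 0 < n.+1%:R :> R[i] by rewrite ltr0n.
rewrite -(ler_pM2l n0); apply: le_trans (h _) _.
rewrite natrD mulrDl mulrDr lerD2l.
move: hn; rewrite ltr_pdivlMr// ltr_pdivrMl// => /ltW.
by apply: le_trans; rewrite lerDl.
Qed.

Lemma separator_linear M : linear (separator S M).
Proof.
move=> k y z; rewrite /separator (cuntz_linear hS).
by elim: M => //= M ->; rewrite (cuntz_linear hS).
Qed.

(** The norm inequality at the heart of the uniqueness of the Cuntz algebra.  The
    window of eta has length N = n + K, where K bounds the shifted degrees of the
    components; on the n indices l with K <= l < N all components of p(T) x
    contribute, so p(S) eta has component p(T) x along each of these J_l. *)
Lemma cuntz_opnorm_le p r :
  opnorm_le (peval S S' p) r -> opnorm_le (peval T T' p) r.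
Proof.
move=> hr x; have r0 := opnorm_le_ge0 hr.
have [d [s [es hs]]] := transport_intertwines p.
move: hr es hs; set a := peval S S' p; set b := peval T T' p => hr es hs.
pose K := \max_(w <- s) w.1.
have wK w : w \in s -> (w.1 <= K)%N by move=> ws; exact: leq_bigmax_seq.
rewrite -(ler_pXn2r (n := 2)) ?nnegrE ?mulr_ge0//.
apply: (@ler_of_natmul_bound _ _ K); first by rewrite exprn_ge0// mulr_ge0.
move=> n; pose N := (n + K)%N; pose M := (N + d + K)%N.
pose J := transport (separator S M).
pose eta := \sum_(m < N) J (m + d)%N x.
pose zeta := \sum_(l < n) J (l + K)%N (b x).
have NN : `|eta| ^+ 2 = N%:R * `|x| ^+ 2.
  rewrite !hH {2}/eta linear_sumr/=.
  under eq_bigr => l _.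
    rewrite dot_sum_transport ?leq_addl ?ltn_add2r ?ltn_ord/=; last 2 first.
    - by rewrite /M /N; lia.
    - by rewrite /M; have := ltn_ord l; lia.
    over.
  by rewrite sumr_const card_ord mulr_natl.
have nn : dot zeta zeta = n%:R * `|b x| ^+ 2.
  rewrite !hH {2}/zeta linear_sumr/=.
  under eq_bigr => l _.
    rewrite dot_sum_transport ?leq_addl ?ltn_add2r ?ltn_ord/=; last 2 first.
    - by rewrite /M /N; lia.
    - by rewrite /M /N; have := ltn_ord l; lia.
    over.
  by rewrite sumr_const card_ord mulr_natl.
have la : linear a := bounded_linear (peval_bounded hS p).
have ae : a eta = \sum_(w <- s) \sum_(m < N) J (m + w.1)%N (w.2 x).
  rewrite /eta (linear_operator_sum _ _ _ la) exchange_big/=.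
  by apply: eq_bigr => m _; rewrite hs//; exact: separator_linear.
have az : dot (a eta) zeta = n%:R * `|b x| ^+ 2.
  rewrite hH /zeta linear_sumr/=.
  under eq_bigr => l _.
    rewrite ae linear_sumlz/= big_seq.
    under eq_bigr => w ws.
      rewrite dot_sum_transport; last 2 first.
      - move: (wK _ ws); rewrite /M /N; set t := w.1; move: t => t tK; lia.
      - by rewrite /M /N; have := ltn_ord l; lia.
      rewrite ifT; last first.
        move: (wK _ ws); rewrite /N; set t := w.1; move: t => t tK.
        by have := ltn_ord l; lia.
      over.
    rewrite -big_seq -linear_sumlz/= -es.
    over.
  by rewrite sumr_const card_ord mulr_natl.
(* Bessel's inequality: zeta is the projection of a eta on a span of ranges. *)
have : 0 <= dot (a eta - zeta) (a eta - zeta) by rewrite -hH exprn_ge0.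
rewrite linearBl !linearBr/= nn (dotC zeta) az -hH.
have -> : (n%:R * `|b x| ^+ 2)^* = n%:R * `|b x| ^+ 2 :> R[i].
  by rewrite -nn -dotC.
rewrite subrr subr0 subr_ge0 => /le_trans; apply.
apply: (@le_trans _ _ ((r * `|eta|) ^+ 2)).
  by rewrite ler_pXn2r// ?nnegrE ?mulr_ge0.
by rewrite !exprMn NN mulrCA.
Qed.

End two_families.

(** * Simultaneous limits *)
Section limits.
Variable P : Type.
Implicit Types (phi psi : P -> H -> H).

(** The closure of the set of pairs (phi p, psi p).  With phi and psi the evaluations
    at two Cuntz families, it is the graph of the isomorphism; with psi the
    evaluation of the formal adjoint, it is the graph of the adjunction. *)
Definition joint_limit phi psi a b : Prop :=
  [/\ bounded_operator a, bounded_operator b &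
      forall e, 0 < e -> exists p,
        opnorm_le (a - phi p) e /\ opnorm_le (b - psi p) e].

Definition dominated phi psi : Prop :=
  forall p q r, opnorm_le (phi p - phi q) r -> opnorm_le (psi p - psi q) r.

Lemma opnorm_le_triangle b a c r s :
  opnorm_le (a - b) r -> opnorm_le (b - c) s -> opnorm_le (a - c) (r + s).
Proof. by move=> h k; have := opnorm_leD h k; rewrite addrA subrK. Qed.

Lemma joint_limit_sym phi psi a b :
  joint_limit phi psi a b -> joint_limit psi phi b a.
Proof.
by case=> ba bb h; split=> // e /h[p [h1 h2]]; exists p.
Qed.

Lemma joint_limit_exists phi psi a :
  (forall p, bounded_operator (psi p)) -> dominated phi psi ->
  bounded_operator a ->
  (forall e, 0 < e -> exists p, opnorm_le (a - phi p) e) ->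
  exists b, joint_limit phi psi a b.
Proof.
move=> bpsi dom ba ha.
have inv0 n : 0 < n.+1%:R^-1 :> R[i] by rewrite invr_gt0 ltr0n.
have /choice[u hu] : forall n : nat, exists p, opnorm_le (a - phi p) n.+1%:R^-1.
  by move=> n; exact: ha.
have mono N n : (N <= n)%N -> n.+1%:R^-1 <= N.+1%:R^-1 :> R[i].
  by move=> Nn; rewrite lef_pV2 ?posrE ?ltr0n// ler_nat.
have [|e e0|b bb hb] := operators_complete (u := fun n => psi (u n)) _ _.
- by move=> n; exact: bpsi.
- have [N hN] := complex_archi (divr_gt0 e0 (ltr0n _ 2)).
  exists N => n m Nn Nm; apply: dom; rewrite [e]splitr.
  apply: (@opnorm_le_triangle a).
    apply: opnorm_leBC; apply: opnorm_leW (hu n).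
    exact: le_trans (mono _ _ Nn) (ltW hN).
  apply: opnorm_leW (hu m); exact: le_trans (mono _ _ Nm) (ltW hN).
exists b; split => // e e0.
have [N hN] := complex_archi e0; have [M hM] := hb e e0.
exists (u (maxn N M)); split; last by apply: hM; exact: leq_maxr.
apply: opnorm_leW (hu _); apply: le_trans (ltW hN).
by apply: mono; exact: leq_maxl.
Qed.

Lemma joint_limit_uniq phi psi a b b' : dominated phi psi ->
  joint_limit phi psi a b -> joint_limit phi psi a b' -> b = b'.
Proof.
move=> dom [_ _ hb] [_ _ hb']; apply: opnorm_le_small => e e0.
have e4 : 0 < e / 4%:R by rewrite divr_gt0// ltr0n.
have [p [ap bp]] := hb _ e4; have [q [aq bq]] := hb' _ e4.
have pq := opnorm_le_triangle (opnorm_leBC ap) aq.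
have := opnorm_le_triangle (opnorm_le_triangle bp (dom _ _ _ pq)) (opnorm_leBC bq).
by apply: opnorm_leW; rewrite le_eqVlt; apply/orP; left; apply/eqP; field.
Qed.

Lemma is_adjoint_joint_limit phi psi a b :
  (forall p, is_adjoint dot (phi p) (psi p)) ->
  joint_limit phi psi a b -> is_adjoint dot a b.
Proof.
move=> adj [_ _ h]; apply: is_adjoint_lim => e /h[p [ap bp]].
by exists (phi p), (psi p).
Qed.

End limits.

(** Composition is locally Lipschitz:
    a b - p q = a (b - q) + (a - p) q. *)
Lemma compose_continuous a b : bounded_operator a -> bounded_operator b ->
  exists2 K : R[i], 0 < K & forall e p q, e <= 1 ->
    opnorm_le (a - p) e -> opnorm_le (b - q) e ->
    opnorm_le ((a \o b) - (p \o q)) (K * e).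
Proof.
move=> [la [r ar]] [_ [s bs]].
have r0 := opnorm_le_ge0 ar; have s0 := opnorm_le_ge0 bs.
exists (r + s + 1); first by rewrite ltr_pwDr ?ltr01// addr_ge0.
move=> e p q e1 ap bq; have e0 := opnorm_le_ge0 ap.
have qs : opnorm_le q (s + 1).
  rewrite -(subrK b q) addrC; apply: opnorm_leD => //.
  exact/opnorm_leBC/(opnorm_leW e1).
have -> : (a \o b) - (p \o q) = (a \o (b - q)) + ((a - p) \o q).
  by apply/funext => x; rewrite !fctE/= (linear_operatorB _ _ la) addrA subrK.
rewrite -addrA mulrDl (mulrC (s + 1)).
by apply: opnorm_leD; exact: opnorm_leM.
Qed.

Section closures.
Variables (S S' T T' : bool -> H -> H).
Hypotheses (hS : cuntz_family S S') (hT : cuntz_family T T').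

Lemma pevalB (W W' : bool -> H -> H) p q :
  peval W W' (PAdd p (PScale (-1) q)) = peval W W' p - peval W W' q.
Proof. by rewrite /= scaleN1r. Qed.

Lemma peval_dominated : dominated (peval S S') (peval T T').
Proof. by move=> p q r; rewrite -!pevalB; exact: (cuntz_opnorm_le hS hT). Qed.

Lemma pstar_dominated : dominated (peval S S') (peval S S' \o pstar).
Proof.
move=> p q r /=; apply: opnorm_le_adjoint.
by apply: is_adjointB; exact: peval_adjoint.
Qed.

Let joint := joint_limit (peval S S') (peval T T').

Lemma joint_limit_gen i : joint (S i) (T i).
Proof.
split; [exact: cuntz_bounded hS i|exact: cuntz_bounded hT i|move=> e e0].
by exists (PGen i); rewrite /= !subrr; split; exact/opnorm_le_0/ltW.
Qed.

Lemma joint_limitD a a' b b' : joint a b -> joint a' b' -> joint (a + a') (b + b').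
Proof.
move=> [ba bb h] [ba' bb' h']; split; [exact: boundedD..|move=> e e0].
have e2 := divr_gt0 e0 (ltr0n _ 2).
have [p [ap bp]] := h _ e2; have [q [aq bq]] := h' _ e2.
exists (PAdd p q); rewrite /= !opprD !(addrACA _ _ (- _)) [e]splitr.
by split; exact: opnorm_leD.
Qed.

Lemma joint_limitZ (k : R[i]) a b : joint a b -> joint (k *: a) (k *: b).
Proof.
move=> [ba bb h]; split; [exact: boundedZ..|move=> e e0].
have k1 : 0 < `|k| + 1 by rewrite ltr_pwDr.
have [p [ap bp]] := h _ (divr_gt0 e0 k1).
have ke : `|k| * (e / (`|k| + 1)) <= e.
  by rewrite mulrCA ger_pMr// ler_pdivrMr// mul1r lerDl.
exists (PScale k p); rewrite /= -!scalerBr.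
by split; apply: (opnorm_leW ke); exact: opnorm_leZ.
Qed.

Lemma joint_limitM a a' b b' :
  joint a b -> joint a' b' -> joint (a \o a') (b \o b').
Proof.
move=> [ba bb h] [ba' bb' h']; split; [exact: boundedM..|move=> e e0].
have [K K0 hK] := compose_continuous ba ba'.
have [L L0 hL] := compose_continuous bb bb'.
(* This tolerance d satisfies d <= 1, K d <= e and L d <= e. *)
pose m := K + L + e; have m0 : 0 < m by rewrite !addr_gt0.
pose d := e / m; have d0 : 0 < d by exact: divr_gt0.
have d1 : d <= 1 by rewrite ler_pdivrMr// mul1r lerDr ltW// addr_gt0.
have Kd : K * d <= e.
  by rewrite mulrCA ger_pMr// ler_pdivrMr// mul1r /m -addrA lerDl ltW// addr_gt0.
have Ld : L * d <= e.
  rewrite mulrCA ger_pMr// ler_pdivrMr// mul1r /m (addrC K) -addrA lerDl.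
  by rewrite ltW// addr_gt0.
have [p [ap bp]] := h _ d0; have [q [aq bq]] := h' _ d0.
exists (PMul p q) => /=.
split; first by apply: (opnorm_leW Kd); exact: hK.
by apply: (opnorm_leW Ld); exact: hL.
Qed.

Lemma joint_limit_adjoint a a' b b' : is_adjoint dot a a' -> is_adjoint dot b b' ->
  joint a b -> joint a' b'.
Proof.
move=> aa' bb' [ba bb h].
split; [exact: is_adjoint_bounded aa' ba|exact: is_adjoint_bounded bb' bb|].
move=> e /h[p [ap bp]]; exists (pstar p); split.
  by apply: opnorm_le_adjoint ap; exact/is_adjointB/peval_adjoint.
by apply: opnorm_le_adjoint bp; exact/is_adjointB/peval_adjoint.
Qed.

End closures.

(** * The C*-algebra of a Cuntz family *)
Section closed_algebra.
Variables (S S' : bool -> H -> H).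
Hypothesis hS : cuntz_family S S'.

Definition peval_closure : set (H -> H) :=
  [set a | bounded_operator a /\
           forall e, 0 < e -> exists p, opnorm_le (a - peval S S' p) e].

Lemma peval_closureP a :
  peval_closure a <-> joint_limit (peval S S') (peval S S') a a.
Proof.
split=> [[ba h]|[ba _ h]]; split=> // e /h.
  by case=> p ap; exists p.
by case=> p [ap _]; exists p.
Qed.

Lemma peval_closure_adjoint a : peval_closure a ->
  is_adjoint dot a (adjoint dot a) /\ peval_closure (adjoint dot a).
Proof.
move=> [ba ha].
have [|b jb] := joint_limit_exists _ (pstar_dominated hS) ba ha.
  by move=> p; exact: peval_bounded.
have ab : is_adjoint dot a b.
  by apply: is_adjoint_joint_limit jb; exact: peval_adjoint.
rewrite (adjointE ab); split=> //; case: jb => _ bb h; split=> // e /h[p [_ bp]].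
by exists (pstar p).
Qed.

Lemma peval_closure_gen i : peval_closure (S i).
Proof. by apply/peval_closureP; exact: joint_limit_gen. Qed.

Lemma cstar_subalgebra_peval_closure : cstar_subalgebra dot peval_closure.
Proof.
split.
- by move=> a [].
- split; first exact: bounded0.
  move=> e e0; exists (PScale 0 (PGen true)); rewrite /= scale0r subrr.
  exact/opnorm_le_0/ltW.
- move=> a b /peval_closureP ja /peval_closureP jb.
  by apply/peval_closureP; exact: joint_limitD.
- by move=> k a /peval_closureP ja; apply/peval_closureP; exact: joint_limitZ.
- move=> a b /peval_closureP ja /peval_closureP jb.
  by apply/peval_closureP; exact: joint_limitM.
- by move=> a /peval_closure_adjoint[].
- move=> a ba h; split=> // e e0; have e2 := divr_gt0 e0 (ltr0n _ 2).
  have [b [_ hb] ab] := h _ e2; have [p bp] := hb _ e2.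
  by exists p; rewrite [e]splitr; exact: opnorm_le_triangle bp.
Qed.

Lemma peval_in_cstar A p : cstar_subalgebra dot A -> (forall i, A (S i)) ->
  A (peval S S' p).
Proof.
move=> hA AS; elim: p => [i|i|p hp q hq|k p hp|p hp q hq] /=.
- exact: AS.
- by rewrite -(adjointE (cuntz_adjoint hS i)); exact: (cstar_adj hA).
- exact: (cstar_add hA).
- exact: (cstar_scale hA).
- exact: (cstar_mul hA).
Qed.

Lemma cstar_generated_cuntz :
  cstar_generated dot [set S true; S false] = peval_closure.
Proof.
apply/seteqP; split.
  apply: smallest_sub; first exact: cstar_subalgebra_peval_closure.
  by move=> a [->|->]; exact: peval_closure_gen.
move=> a [ba ha] A [hA GA].
apply: (cstar_closed hA ba) => e /ha[p ap]; exists (peval S S' p) => //.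
by apply: peval_in_cstar => // -[]; apply: GA; [left|right].
Qed.

Lemma peval_closure_id : peval_closure idfun.
Proof.
have -> : (idfun : H -> H) = \sum_(i : bool) (S i \o S' i).
  by apply/funext => x; rewrite fct_sumE/= (cuntz_sum hS).
have hA := cstar_subalgebra_peval_closure.
rewrite big_bool/=; apply: (cstar_add hA); apply: (cstar_mul hA);
  rewrite -?(adjointE (cuntz_adjoint hS _)); try apply: (cstar_adj hA);
  exact: peval_closure_gen.
Qed.

End closed_algebra.

(** Uniqueness of the Cuntz algebra.  The isomorphism a |-> b is read off the graph
    of joint limits, which is single-valued and total in both directions because
    the norm inequality holds in both directions. *)
Lemma peval_closure_isomorphic (S S' T T' : bool -> H -> H) :
  cuntz_family S S' -> cuntz_family T T' ->
  star_isomorphic dot (peval_closure S S') (peval_closure T T').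
Proof.
move=> hS hT; have domST := peval_dominated hS hT; have domTS := peval_dominated hT hS.
pose j := joint_limit (peval S S') (peval T T').
pose f a := xget (0 : H -> H) [set b | j a b].
have jl a b : j a b -> peval_closure S S' a.
  by case=> ba _ h; split=> // e /h[p [? _]]; exists p.
have jr a b : j a b -> peval_closure T T' b.
  by case=> _ bb h; split=> // e /h[p [_ ?]]; exists p.
have jf a : peval_closure S S' a -> j a (f a).
  move=> [ba ha]; apply: (@xgetPex _ (0 : H -> H) [set b | j a b]).
  have [|b jb] := joint_limit_exists _ domST ba ha; last by exists b.
  by move=> p; exact: peval_bounded.
have jE a b : j a b -> f a = b.
  by move=> jb; exact: joint_limit_uniq domST (jf _ (jl _ _ jb)) jb.
exists f; split.
- split.
  + by move=> a /jf/jr.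
  + move=> a b /[!inE] /jf ja /jf jb fab; rewrite -fab in jb.
    exact: joint_limit_uniq domTS (joint_limit_sym ja) (joint_limit_sym jb).
  + move=> b [bb hb].
    have [|a ja] := joint_limit_exists _ domTS bb hb.
      by move=> p; exact: peval_bounded.
    by move/joint_limit_sym: ja => ja; exists a; [exact: jl ja|exact: jE].
- by move=> a b /jf ja /jf jb; apply: jE; exact: joint_limitD.
- by move=> k a /jf ja; apply: jE; exact: joint_limitZ.
- by move=> a b /jf ja /jf jb; apply: jE; exact: joint_limitM.
- move=> a Aa; have ja := jf _ Aa; apply: jE.
  apply: (joint_limit_adjoint hS hT _ _ ja).
    by case: (peval_closure_adjoint hS Aa).
  by case: (peval_closure_adjoint hT (jr _ _ ja)).
Qed.

(** * Continuity of algebraic *-isomorphisms *)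
Section continuity.
Variable A : set (H -> H).
Hypotheses (hA : cstar_subalgebra dot A) (A1 : A idfun).
Hypothesis A_adjoint : forall a, A a -> is_adjoint dot a (adjoint dot a).

Lemma cstar_bounded_operator a : A a -> bounded_operator a.
Proof. exact: cstar_bounded hA a. Qed.

Lemma cstar_sub a b : A a -> A b -> A (a - b).
Proof.
move=> Aa Ab; rewrite -scaleN1r; apply: (cstar_add hA) => //.
exact: (cstar_scale hA).
Qed.

Lemma half_exp_le n : 2^-1 ^+ n <= n.+1%:R^-1 :> R[i].
Proof.
rewrite exprVn lef_pV2 ?posrE ?ltr0n ?exprn_gt0//.
by rewrite -natrX ler_nat ltn_expl.
Qed.

(** Solves x = (b + x x) / 2, so that (1 - x)(1 - x) = 1 - b.  On the ball of radius
    1/2 the map is a contraction with ratio 1/2, since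
    x x - y y = x (x - y) + (x - y) y. *)
Lemma cstar_sqrt_fixpoint b : A b -> is_adjoint dot b b -> opnorm_le b 2^-1 ->
  exists c, [/\ A c, is_adjoint dot c c & c = 2^-1 *: (b + (c \o c))].
Proof.
move=> Ab bb nb; pose g c := 2^-1 *: (b + (c \o c)) : H -> H.
pose u n := iter n g (0 : H -> H).
have h0 : 0 <= 2^-1 :> R[i] by rewrite invr_ge0 ler0n.
have h1 : 2^-1 <= 1 :> R[i] by rewrite invf_le1 ?ltr0n// ler1n.
have nh : `|2^-1| = 2^-1 :> R[i] by rewrite ger0_norm.
have Au n : A (u n).
  elim: n => [|n IH]; first exact: (cstar_zero hA).
  by apply: (cstar_scale hA); apply: (cstar_add hA) => //; exact: (cstar_mul hA).
have bu n : bounded_operator (u n) by exact/cstar_bounded_operator.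
have su n : is_adjoint dot (u n) (u n).
  elim: n => [|n IH].
    by move=> x y; rewrite /= -![GRing.zero _]/(0 : H) linear0l linear0r.
  have /(is_adjointZ 2^-1) := is_adjointD bb (is_adjointM IH IH).
  rewrite conj_Creal ?ger0_real// => h; exact: h.
have nu n : opnorm_le (u n) 2^-1.
  elim: n => [|n IH]; first exact: opnorm_le_0.
  have := opnorm_leZ 2^-1 (opnorm_leD nb (opnorm_leM IH IH)).
  rewrite nh; apply: opnorm_leW.
  by rewrite ler_piMr// [leRHS]splitr div1r lerD2l ler_piMr.
have step n k : opnorm_le (u (n + k)%N - u n) (2^-1 ^+ n).
  elim: n => [|n IH].
    by rewrite subr0 add0n expr0; exact: opnorm_leW (nu k).
  have -> : u (n.+1 + k)%N - u n.+1 =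
      2^-1 *: ((u (n + k)%N \o (u (n + k)%N - u n)) +
               ((u (n + k)%N - u n) \o u n)).
    rewrite addSn {1 2}/u !iterS -!/(u _) /g -scalerBr opprD addrACA subrr add0r.
    congr (_ *: _); apply/funext => x; rewrite !fctE/=.
    by rewrite (linear_operatorB _ _ (bounded_linear (bu _))) addrA subrK.
  have := opnorm_leZ 2^-1 (opnorm_leD (opnorm_leM (nu (n + k)%N) IH)
                                      (opnorm_leM IH (nu n))).
  rewrite nh; apply: opnorm_leW.
  rewrite exprS le_eqVlt; apply/orP; left; apply/eqP.
  by move: (_ ^+ n) => q; field.
have [e e0|x bx hx] := operators_complete (u := u) bu.
  have [N hN] := complex_archi (divr_gt0 e0 (ltr0n _ 2)).
  exists N => n m Nn Nm; rewrite [e]splitr.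
  have hN' := le_trans (half_exp_le N) (ltW hN).
  apply: (@opnorm_le_triangle (u N)); last apply: opnorm_leBC.
    by rewrite -(subnKC Nn); exact: opnorm_leW (step _ _).
  by rewrite -(subnKC Nm); exact: opnorm_leW (step _ _).
have Ax : A x.
  apply: (cstar_closed hA bx) => e /hx[N hN]; exists (u N) => //.
  exact: hN.
exists x; split=> //.
  apply: is_adjoint_lim => e /hx[N hN]; exists (u N), (u N); split=> //; exact: hN.
have [K K0 hK] := compose_continuous bx bx.
apply: opnorm_le_small => e e0.
have m0 : 0 < K + e + 1 by rewrite !addr_gt0.
have d0 : 0 < e / (K + e + 1) by exact: divr_gt0.
have d1 : e / (K + e + 1) <= 1.
  by rewrite ler_pdivrMr// mul1r -addrA addrCA lerDl ltW// addr_gt0.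
have [N hN] := hx _ d0; have xN := hN _ (leqnn N).
have xN1 := hN _ (leqnSn N).
have := opnorm_leZ 2^-1 (opnorm_leBC (hK _ _ _ d1 xN xN)).
have -> : 2^-1 *: ((u N \o u N) - (x \o x)) = u N.+1 - g x.
  by rewrite {3}/u iterS -/(u N) /g -scalerBr opprD addrACA subrr add0r.
move=> /(opnorm_le_triangle xN1); apply: opnorm_leW.
rewrite nh; apply: (@le_trans _ _ ((1 + K) * (e / (K + e + 1)))).
  by rewrite mulrDl mul1r lerD2l ler_piMl// mulr_ge0 ?ltW.
rewrite mulrCA ger_pMr// ler_pdivrMr// mul1r.
have -> : K + e + 1 = 1 + K + e by ring. 
by rewrite lerDl ltW.
Qed.

Lemma cstar_sqrt a : A a -> opnorm_le a 2^-1 ->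
  exists c, [/\ A c, is_adjoint dot c c &
    c \o c = idfun - (adjoint dot a \o a)].
Proof.
move=> Aa na; have aa := A_adjoint Aa.
have Ab : A (adjoint dot a \o a) by apply: (cstar_mul hA) => //; exact: (cstar_adj hA).
have sb : is_adjoint dot (adjoint dot a \o a) (adjoint dot a \o a).
  exact: is_adjointM (is_adjoint_sym aa) aa.
have nb : opnorm_le (adjoint dot a \o a) 2^-1.
  apply: opnorm_leW (opnorm_leM (opnorm_le_adjoint aa na) na).
  by rewrite ler_piMr ?invr_ge0 ?ler0n// invf_le1 ?ltr0n// ler1n.
have [c [Ac sc ec]] := cstar_sqrt_fixpoint Ab sb nb.
exists (idfun - c); split; first exact: cstar_sub.
  by apply: is_adjointB => // x y.
have lc := bounded_linear (cstar_bounded_operator Ac).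
apply/funext => x; rewrite !fctE/= (linear_operatorB _ _ lc).
have : c x *+ 2 = adjoint dot a (a x) + c (c x).
  rewrite {1}ec !fctE/= -scaler_nat scalerA mulfV ?pnatr_eq0// scale1r; exact: erefl.
move=> e2; rewrite -addrA; congr (_ + _).
by rewrite opprB addrCA -opprD -mulr2n e2 opprD addrCA subrr addr0.
Qed.

Lemma star_isomorphism_zero B f : star_isomorphism dot A B f -> f 0 = 0.
Proof.
move=> hf; have A0 := cstar_zero hA.
by rewrite -[X in f X](scale0r (0 : H -> H)) (star_scale hf _ A0) scale0r.
Qed.

Lemma star_isomorphismB B f a b : star_isomorphism dot A B f -> A a -> A b ->
  f (a - b) = f a - f b.
Proof.
move=> hf Aa Ab; rewrite -scaleN1r (star_add hf)//.
  by rewrite (star_scale hf)// scaleN1r.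
exact: (cstar_scale hA).
Qed.

(** For |a| <= 1/2, write 1 - a' a = c c with c self-adjoint.  Then
    |f(a) x|^2 = |x|^2 - |f(c) x|^2 <= |x|^2; the general case follows by scaling. *)
Lemma star_isomorphism_continuous B f a r :
  (forall b, B b -> is_adjoint dot b (adjoint dot b)) ->
  star_isomorphism dot A B f -> f idfun = idfun ->
  A a -> 0 < r -> opnorm_le a r -> opnorm_le (f a) (2%:R * r).
Proof.
move=> hB hf f1.
have Bf c : A c -> B (f c) by case: (star_bij hf) => h _ _; exact: h.
have half c : A c -> opnorm_le c 2^-1 -> opnorm_le (f c) 1.
  move=> Ac nc; have [d [Ad sd ed]] := cstar_sqrt Ac nc.
  have Aac := cstar_adj hA Ac.
  have fd : f d \o f d = idfun - (adjoint dot (f c) \o f c).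
    rewrite -(star_mul hf)// ed (star_isomorphismB hf)//; last exact: (cstar_mul hA).
    by rewrite f1 (star_mul hf)// (star_adj hf).
  have sfd : is_adjoint dot (f d) (f d).
    have := hB _ (Bf _ Ad).
    by rewrite -(star_adj hf)// (adjointE sd).
  move=> x; rewrite mul1r -(ler_pXn2r (n := 2)) ?nnegrE// !hH.
  rewrite (hB _ (Bf _ Ac)).
  have -> : adjoint dot (f c) (f c x) = x - f d (f d x).
    have := congr1 (fun h => h x) fd; rewrite !fctE/= => ->.
    by rewrite opprB addrCA subrr addr0.
  by rewrite linearBr/= -sfd lerBlDr lerDl -hH exprn_ge0.
move=> Aa r0 ar; have r2 : 0 < 2%:R * r by rewrite mulr_gt0// ltr0n.
have : opnorm_le ((2%:R * r)^-1 *: a) 2^-1.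
  apply: opnorm_leW (opnorm_leZ _ ar).
  by rewrite gtr0_norm ?invr_gt0// invfM -mulrA mulVf ?gt_eqF// mulr1.
move/(half _ (cstar_scale hA _ Aa)); rewrite (star_scale hf)//.
move=> /(opnorm_leZ (2%:R * r)).
by rewrite scalerA mulfV ?gt_eqF// scale1r mulr1 gtr0_norm.
Qed.

End continuity.

(** * The pair (T, V) *)

(** If no adjoint existed, the chosen one would be 0 and could not be a left inverse
    on a nonzero space. *)
Lemma isometry_is_adjoint a :
  isometry_operator dot a -> is_adjoint dot a (adjoint dot a).
Proof.
move=> [_ e]; apply: (@xgetPex _ (0 : H -> H) [set b | is_adjoint dot a b]).
have [//|none] := pselect (exists b, is_adjoint dot a b).
have [x /eqP x0] := H_nonzero; exfalso; apply: x0.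
have := congr1 (fun f => f x) e; rewrite /= /adjoint xgetPN.
  by move=> <-.
by move=> b ab; apply: none; exists b.
Qed.

(** Orthogonality of the ranges follows from the other relations: applying
    1 = S_i S_i' + S_j S_j' to S_j x gives S_i S_i' S_j x = 0. *)
Lemma cuntz_family_intro (S S' : bool -> H -> H) :
  (forall i, linear (S i)) -> (forall i, is_adjoint dot (S i) (S' i)) ->
  (forall i x, S' i (S i x) = x) ->
  (forall x, S true (S' true x) + S false (S' false x) = x) ->
  cuntz_family S S'.
Proof.
move=> lS aS iS sS; split=> // [i j x|x]; last by rewrite big_bool; exact: sS.
have lS' k : linear (S' k) := is_adjoint_linear (aS k).
case: eqP => [<-|/eqP ij]; first exact: iS.
rewrite -[LHS](iS i).
suff -> : S i (S' i (S j x)) = 0 by rewrite (linear_operator0 (lS' i)).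
have := sS (S j x); case: i j ij => [] [] // _; rewrite iS => /eqP.
  by rewrite -subr_eq0 addrK => /eqP.
by rewrite addrC -subr_eq0 addrK => /eqP.
Qed.

Lemma addr_addrB (x y : H) : x + y + (x - y) = x + x.
Proof. by rewrite addrACA subrr addr0. Qed.

Section fixed_points.
Variables (S S' : bool -> H -> H).
Hypothesis hS : cuntz_family S S'.

Let k : R[i] := (Num.sqrt (2 : R))^-1%:C.
Let U := (S true \o S' true) - (S false \o S' false).
Let T := k *: (S true + S false).
Let V := U \o T \o U.

Let lS i : linear (S i) := cuntz_linear hS i.
Let lS' i : linear (S' i) := cuntz_adjoint_linear hS i.

Lemma half_sqrt : k * k = 2^-1.
Proof.
rewrite /k -rmorphM/= -invfM -expr2 sqr_sqrtr ?ler0n// fmorphV/=.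
by rewrite rmorph_nat.
Qed.

Lemma half_sqrt_conj : k^* = k.
Proof. by rewrite conj_Creal// ger0_real// ler0c invr_ge0 sqrtr_ge0. Qed.

Lemma half_sqrt_double x : k *: (k *: (x + x)) = x.
Proof.
by rewrite scalerA half_sqrt scalerDr -scalerDl -[2^-1]div1r -splitr scale1r.
Qed.

(** U is the reflection that is 1 on the range of S_true and -1 on the range of
    S_false. *)
Lemma symmetry_true x : U (S true x) = S true x.
Proof.
by rewrite /U !fctE/= !(cuntz_orth hS)/= (linear_operator0 (@lS false)) subr0.
Qed.

Lemma symmetry_false x : U (S false x) = - S false x.
Proof.
by rewrite /U !fctE/= !(cuntz_orth hS)/= (linear_operator0 (@lS true)) sub0r.
Qed.

Lemma symmetry_linear : linear U.
Proof.
have bU : bounded_operator U.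
  apply: boundedB; apply: boundedM;
  by [exact: cuntz_bounded hS _|exact: cuntz_adjoint_bounded hS _].
exact: bounded_linear.
Qed.

Lemma symmetry_self_adjoint : is_adjoint dot U U.
Proof.
have aS i := cuntz_adjoint hS i.
apply: is_adjointB.
  exact: is_adjointM (aS true) (is_adjoint_sym (aS true)).
exact: is_adjointM (aS false) (is_adjoint_sym (aS false)).
Qed.

Lemma symmetry_involutive x : U (U x) = x.
Proof.
rewrite {2}/U !fctE/= (linear_operatorB _ _ symmetry_linear).
rewrite symmetry_true symmetry_false opprK.
by have := cuntz_sum hS x; rewrite big_bool.
Qed.

Lemma symmetry_adj_true x : S' true (U x) = S' true x.
Proof.
rewrite /U !fctE/= (linear_operatorB _ _ (@lS' true)) !(cuntz_orth hS)/=.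
by rewrite subr0.
Qed.

Lemma symmetry_adj_false x : S' false (U x) = - S' false x.
Proof.
rewrite /U !fctE/= (linear_operatorB _ _ (@lS' false)) !(cuntz_orth hS)/=.
by rewrite sub0r.
Qed.

Lemma symmetry_opnorm : opnorm_le U 1.
Proof.
move=> x; rewrite mul1r -(ler_pXn2r (n := 2)) ?nnegrE// !hH.
by rewrite symmetry_self_adjoint symmetry_involutive.
Qed.

Lemma symmetry_bounded : bounded_operator U.
Proof. by split; [exact: symmetry_linear|exists 1; exact: symmetry_opnorm]. Qed.

Lemma symmetry_comp_T x : U (T x) = k *: (S true x - S false x).
Proof.
rewrite /T !fctE (linear_operatorZ _ _ symmetry_linear).
by rewrite (linear_operatorD _ _ symmetry_linear) symmetry_true symmetry_false.
Qed.

Lemma conj_symmetry_formula : V = k *: ((S true - S false) \o U).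
Proof. by apply/funext => x; rewrite /V/= symmetry_comp_T. Qed.

Lemma generator_true_split : S true = k *: T + ((k *: V) \o U).
Proof.
apply/funext => x; rewrite !fctE/= /V/= symmetry_involutive symmetry_comp_T /T !fctE.
by rewrite -scalerDr -scalerDr addr_addrB half_sqrt_double.
Qed.

Lemma generator_false_split : S false = k *: T - ((k *: V) \o U).
Proof.
apply/funext => x; rewrite !fctE/= /V/= symmetry_involutive symmetry_comp_T /T !fctE.
rewrite -scalerBr -scalerBr opprB (addrC (S true x)).
by rewrite addr_addrB half_sqrt_double.
Qed.

Let T' := k *: (S' true + S' false).
Let W i := if i then T else V.
Let W' i := if i then T' else U \o T' \o U.

(** The pair (T, V) is again a Cuntz family.  For the sum of the range projections,
    T T' = (S1 + S2)(S1' + S2') / 2 and V V' = U T T' U = (S1 - S2)(S1' - S2') / 2,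
    so the mixed terms cancel. *)
Lemma cuntz_family_TV : cuntz_family W W'.
Proof.
have aT : is_adjoint dot T T'.
  rewrite /T' -half_sqrt_conj; apply: is_adjointZ.
  by apply: is_adjointD; exact: cuntz_adjoint hS _.
have bT : bounded_operator T.
  by apply: boundedZ; apply: boundedD; exact: cuntz_bounded hS _.
have T'T x : T' (T x) = x.
  rewrite /T' /T !fctE !(linear_operatorZ _ _ (@lS' _)).
  rewrite !(linear_operatorD _ _ (@lS' _)) !(cuntz_orth hS)/=.
  by rewrite addr0 add0r -scalerDr half_sqrt_double.
apply: cuntz_family_intro.
- case; first exact: bounded_linear.
  by apply/bounded_linear/boundedM; [exact: boundedM symmetry_bounded bT|
                                    exact: symmetry_bounded].
- case=> //; apply: is_adjointM symmetry_self_adjoint.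
  exact: is_adjointM symmetry_self_adjoint aT.
- case=> x; first exact: T'T.
  by rewrite /= /V/= symmetry_involutive T'T symmetry_involutive.
- move=> x; rewrite /= /V/= symmetry_involutive symmetry_comp_T /T /T' !fctE.
  rewrite symmetry_adj_true symmetry_adj_false.
  rewrite !(linear_operatorZ _ _ (@lS _)) !(linear_operatorD _ _ (@lS _)).
  rewrite !(linear_operatorN _ (@lS _)) -scalerBr -!scalerDr addrACA addr_addrB.
  rewrite opprB (addrC (S false (S' true x))) addr_addrB addrACA half_sqrt_double.
  by have := cuntz_sum hS x; rewrite big_bool.
Qed.

(** * The fixed point algebra *)
Let O := peval_closure S S'.
Let D := peval_closure W W'.
Let hO : cstar_subalgebra dot O := cstar_subalgebra_peval_closure hS.
Let hD : cstar_subalgebra dot D := cstar_subalgebra_peval_closure cuntz_family_TV.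

(** Conjugation by U exchanges T and V, so the elements of D whose conjugate lies in
    D form a C*-algebra that contains T and V. *)
Lemma conj_symmetry_closed a : D a -> D (U \o a \o U).
Proof.
suff : D `<=` [set b | D b /\ D (U \o b \o U)] by move=> h /h[].
have lU := symmetry_linear; have sU := symmetry_self_adjoint.
rewrite {1}/D -(cstar_generated_cuntz cuntz_family_TV); apply: smallest_sub; last first.
  have DT : D T := peval_closure_gen cuntz_family_TV true.
  have DV : D V := peval_closure_gen cuntz_family_TV false.
  move=> b [->|->]; split=> //.
  have -> : U \o W false \o U = T.
    by apply/funext => x; rewrite /= /V/= !symmetry_involutive.
  exact: DT.
have U0 : U \o (0 : H -> H) \o U = 0.
  by apply/funext => x; rewrite /= (linear_operator0 lU).
split.
- by move=> b [/(cstar_bounded hD)].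
- by split; rewrite ?U0; exact: (cstar_zero hD).
- move=> b c [Db Ub] [Dc Uc]; split; first exact: (cstar_add hD).
  have -> : U \o (b + c) \o U = (U \o b \o U) + (U \o c \o U).
    by apply/funext => x; rewrite !fctE/= (linear_operatorD _ _ lU).
  exact: (cstar_add hD).
- move=> l b [Db Ub]; split; first exact: (cstar_scale hD).
  have -> : U \o (l *: b) \o U = l *: (U \o b \o U).
    by apply/funext => x; rewrite !fctE/= (linear_operatorZ _ _ lU).
  exact: (cstar_scale hD).
- move=> b c [Db Ub] [Dc Uc]; split; first exact: (cstar_mul hD).
  have -> : U \o (b \o c) \o U = (U \o b \o U) \o (U \o c \o U).
    by apply/funext => x; rewrite /= symmetry_involutive.
  exact: (cstar_mul hD).
- move=> b [Db Ub]; have [ab Db'] := peval_closure_adjoint cuntz_family_TV Db.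
  split=> //.
  have /adjointE <- : is_adjoint dot (U \o b \o U) (U \o adjoint dot b \o U).
    exact: is_adjointM (is_adjointM sU ab) sU.
  exact: (cstar_adj hD).
- move=> b bb h; split.
    by apply: (cstar_closed hD bb) => e /h[c [Dc _]]; exists c.
  apply: (cstar_closed hD).
    by apply: boundedM symmetry_bounded; apply: boundedM bb; exact: symmetry_bounded.
  move=> e /h[c [Dc Uc] bc]; exists (U \o c \o U) => //.
  have -> : (U \o b \o U) - (U \o c \o U) = U \o (b - c) \o U.
    by apply/funext => x; rewrite !fctE/= (linear_operatorB _ _ lU).
  rewrite -[e]mul1r -[X in opnorm_le _ X]mulr1.
  by apply: opnorm_leM symmetry_opnorm; apply: opnorm_leM bc; exact: symmetry_opnorm.
Qed.

Lemma symmetry_in_cuntz : O U.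
Proof.
have OS' i : O (S' i).
  rewrite -(adjointE (cuntz_adjoint hS i)).
  exact/(cstar_adj hO)/(peval_closure_gen hS).
by apply: (cstar_sub hO); apply: (cstar_mul hO) => //; exact: (peval_closure_gen hS).
Qed.

Section flip.
Variable sigma : (H -> H) -> (H -> H).
Hypothesis hsigma : star_automorphism dot O sigma.
Hypothesis sigmaS : forall i, sigma (S i) = S (~~ i).

Lemma flip_adj i : sigma (S' i) = S' (~~ i).
Proof.
rewrite -!(adjointE (cuntz_adjoint hS _)) (star_adj hsigma) ?sigmaS//.
exact: (peval_closure_gen hS).
Qed.

Let OS i : O (S i) := peval_closure_gen hS i.

Let OS' i : O (S' i).
Proof. by rewrite -(adjointE (cuntz_adjoint hS i)); exact/(cstar_adj hO). Qed.

Let flip_range_closed i : O (S i \o S' i) := cstar_mul hO (OS i) (OS' i).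

Lemma flip_range i : sigma (S i \o S' i) = S (~~ i) \o S' (~~ i).
Proof. by rewrite (star_mul hsigma (OS i) (OS' i)) sigmaS flip_adj. Qed.

Lemma flip_id : sigma idfun = idfun.
Proof.
have e : (idfun : H -> H) = (S true \o S' true) + (S false \o S' false).
  by apply/funext => x; have := cuntz_sum hS x; rewrite big_bool.
apply: etrans (congr1 sigma e) _.
apply: etrans (star_add hsigma (flip_range_closed true) (flip_range_closed false)) _.
rewrite !flip_range/=; exact: etrans (addrC _ _) (esym e).
Qed.

(** The flip exchanges the two range projections, of which U is the difference. *)
Lemma flip_symmetry : sigma U = - U.
Proof.
apply: etrans
  (star_isomorphismB hO hsigma (flip_range_closed true) (flip_range_closed false)) _.
by rewrite !flip_range/= opprB.
Qed.

Lemma flip_continuous a r : O a -> 0 < r -> opnorm_le a r ->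
  opnorm_le (sigma a) (2%:R * r).
Proof.
have adj b : O b -> is_adjoint dot b (adjoint dot b).
  by move=> /(peval_closure_adjoint hS)[].
exact: (star_isomorphism_continuous hO (peval_closure_id hS) adj adj hsigma flip_id).
Qed.

Let OB a b : O a -> O b -> O (a - b) := @cstar_sub O hO a b.

Lemma cstar_subalgebra_fixed : cstar_subalgebra dot [set a | O a /\ sigma a = a].
Proof.
split.
- by move=> a [/(cstar_bounded hO)].
- by split; [exact: (cstar_zero hO)|exact: (star_isomorphism_zero hO hsigma)].
- move=> a b [Oa ea] [Ob eb]; split; first exact: (cstar_add hO).
  by rewrite (star_add hsigma)// ea eb.
- move=> l a [Oa ea]; split; first exact: (cstar_scale hO).
  by rewrite (star_scale hsigma)// ea.
- move=> a b [Oa ea] [Ob eb]; split; first exact: (cstar_mul hO).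
  by rewrite (star_mul hsigma)// ea eb.
- move=> a [Oa ea]; split; first exact: (cstar_adj hO).
  by rewrite (star_adj hsigma)// ea.
move=> a ba h; have Oa : O a.
  by apply: (cstar_closed hO ba) => e /h[b [Ob _] ab]; exists b.
split=> //; apply: opnorm_le_small => e e0.
have e3 : 0 < e / 3%:R by rewrite divr_gt0// ltr0n.
have [b [Ob eb] ab] := h _ e3.
have := flip_continuous (OB Oa Ob) e3 ab.
rewrite (star_isomorphismB hO hsigma)// eb.
move=> /opnorm_le_triangle/(_ (opnorm_leBC ab)); apply: opnorm_leW.
by rewrite le_eqVlt; apply/orP; left; apply/eqP; field.
Qed.

Lemma T_in_cuntz : O T.
Proof. by apply: (cstar_scale hO); exact: (cstar_add hO). Qed.

Lemma cuntz_TV_fixed : D `<=` [set a | O a /\ sigma a = a].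
Proof.
rewrite /D -(cstar_generated_cuntz cuntz_family_TV).
have OU := symmetry_in_cuntz; have oT := T_in_cuntz.
have sT : sigma T = T.
  rewrite /T (star_scale hsigma); last exact: (cstar_add hO).
  by rewrite (star_add hsigma)// !sigmaS/= addrC.
apply: smallest_sub; first exact: cstar_subalgebra_fixed.
move=> a [->|->]; first by split.
have OUT : O (U \o T) by exact: (cstar_mul hO).
split; first exact: (cstar_mul hO).
apply: etrans (star_mul hsigma OUT OU) _.
rewrite (star_mul hsigma OU oT) sT flip_symmetry.
have lT : linear T := cuntz_linear cuntz_family_TV true.
apply/funext => x; rewrite /= -[(- U) x]/(- U x) (linear_operatorN _ lT).
by rewrite -[(- U) (- _)]/(- U (- _)) (linear_operatorN _ symmetry_linear) opprK.
Qed.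

Lemma flip_decomposition b c : D b -> D c ->
  sigma (b + (c \o U)) = b - (c \o U).
Proof.
move=> Db Dc; have [Ob sb] := cuntz_TV_fixed Db; have [Oc sc] := cuntz_TV_fixed Dc.
have OU := symmetry_in_cuntz; have OcU := cstar_mul hO Oc OU.
rewrite (star_add hsigma Ob OcU) (star_mul hsigma Oc OU) sb sc flip_symmetry.
congr (_ + _); apply/funext => x; rewrite /=.
have lc : linear c := bounded_linear (cstar_bounded hD Dc).
by rewrite -[(- U) x]/(- U x) (linear_operatorN _ lc).
Qed.

Lemma eq_half_of_double (a b : H -> H) : a + a = b -> a = 2^-1 *: b.
Proof.
by move=> <-; rewrite scalerDr -scalerDl -[2^-1]div1r -splitr scale1r.
Qed.

(** The space D + D U is closed under products because conjugation by U preserves D.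
    It is norm-closed because both coefficients of a = b + c U depend continuously
    on a: b = (a + sigma a) / 2 and c = (a - sigma a) U / 2. *)
Lemma cstar_subalgebra_decomposition :
  cstar_subalgebra dot [set a | O a /\ exists b c, [/\ D b, D c & a = b + (c \o U)]].
Proof.
have lU := symmetry_linear; have sU := symmetry_self_adjoint.
have lD b : D b -> linear b by move=> Db; exact: bounded_linear (cstar_bounded hD Db).
have OU := symmetry_in_cuntz.
split.
- by move=> a [/(cstar_bounded hO)].
- have D0 := cstar_zero hD.
  by split; [exact: (cstar_zero hO)|exists 0, 0; split=> //; rewrite add0r].
- move=> a a' [Oa [b [c [Db Dc e]]]] [Oa' [b' [c' [Db' Dc' e']]]].
  split; first exact: (cstar_add hO Oa Oa').
  rewrite {}e {}e'.
  exists (b + b'), (c + c'); split; [exact: (cstar_add hD)..|].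
  by apply/funext => x; rewrite !fctE/= addrACA.
- move=> l a [Oa [b [c [Db Dc e]]]].
  split; first exact: (cstar_scale hO l Oa).
  rewrite {}e.
  exists (l *: b), (l *: c); split; [exact: (cstar_scale hD)..|].
  by apply/funext => x; rewrite !fctE/= scalerDr.
- move=> a a' [Oa [b [c [Db Dc e]]]] [Oa' [b' [c' [Db' Dc' e']]]].
  split; first exact: (cstar_mul hO Oa Oa').
  rewrite {}e {}e'.
  exists ((b \o b') + (c \o (U \o c' \o U))), ((b \o c') + (c \o (U \o b' \o U))).
  have Ub' := conj_symmetry_closed Db'; have Uc' := conj_symmetry_closed Dc'.
  split.
  + by apply: (cstar_add hD); exact: (cstar_mul hD).
  + by apply: (cstar_add hD); exact: (cstar_mul hD).
  apply/funext => x; rewrite !fctE/= symmetry_involutive.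
  rewrite (linear_operatorD _ _ (lD _ Db)) (linear_operatorD _ _ lU).
  rewrite (linear_operatorD _ _ (lD _ Dc)) -!addrA; congr (_ + _).
  by rewrite addrCA; congr (_ + _); rewrite addrC.
- move=> a [Oa [b [c [Db Dc e]]]].
  split; first exact: (cstar_adj hO Oa).
  have [ab Db'] := peval_closure_adjoint cuntz_family_TV Db.
  have [ac Dc'] := peval_closure_adjoint cuntz_family_TV Dc.
  exists (adjoint dot b), (U \o adjoint dot c \o U); split=> //.
    exact: conj_symmetry_closed.
  rewrite e; apply: adjointE.
  have -> : U \o adjoint dot c \o U \o U = U \o adjoint dot c.
    by apply/funext => x; rewrite /= symmetry_involutive.
  exact: is_adjointD ab (is_adjointM ac sU).
move=> a ba h; have Oa : O a.
  by apply: (cstar_closed hO ba) => e /h[b [Ob _] ab]; exists b.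
split=> //; have Osa : O (sigma a) by case: (star_bij hsigma) => f _ _; exact: f.
pose b := 2^-1 *: (a + sigma a); pose d := 2^-1 *: (a - sigma a).
have bsa : bounded_operator (sigma a) := cstar_bounded hO Osa.
have bd : bounded_operator d by apply: boundedZ; exact: boundedB.
have close e : 0 < e -> exists b' c', [/\ D b', D c',
    opnorm_le (b - b') e & opnorm_le ((d \o U) - c') e].
  move=> e0; have e3 : 0 < e / 2%:R by rewrite divr_gt0// ltr0n.
  have [a' [Oa' [b' [c' [Db' Dc' ea']]]] aa'] := h _ e3.
  have saa' : opnorm_le (sigma a - sigma a') (2%:R * (e / 2%:R)).
    rewrite -(star_isomorphismB hO hsigma)//.
    by apply: flip_continuous => //; exact: OB.
  have sa' := flip_decomposition Db' Dc'; rewrite -ea' in sa'.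
  have bound : 2^-1 * (e / 2%:R + 2%:R * (e / 2%:R)) <= e.
    rewrite -subr_ge0.
    have -> : e - 2^-1 * (e / 2%:R + 2%:R * (e / 2%:R)) = e / 4%:R by field.
    by rewrite divr_ge0 ?ler0n// ltW.
  have half (f : H -> H) r : opnorm_le f r -> opnorm_le (2^-1 *: f) (2^-1 * r).
    move=> fr; have := opnorm_leZ 2^-1 fr.
    by rewrite ger0_norm// invr_ge0 ler0n.
  exists b', c'; split=> //.
  - have -> : b' = 2^-1 *: (a' + sigma a').
      by apply: eq_half_of_double; rewrite sa' ea' addrACA subrr addr0.
    rewrite /b -scalerBr opprD addrACA; apply: (opnorm_leW bound).
    by apply: half; exact: opnorm_leD.
  - have dE : (c' \o U) = 2^-1 *: (a' - sigma a').
      by apply: eq_half_of_double; rewrite sa' ea' opprB (addrC b') addrACA subrr addr0.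
    have -> : (d \o U) - c' = (2^-1 *: ((a - a') - (sigma a - sigma a'))) \o U.
      apply/funext => x; have := congr1 (fun f => f (U x)) dE.
      rewrite /d !fctE/= symmetry_involutive => ->.
      rewrite -scalerBr; congr (_ *: _).
      by rewrite !opprB addrACA [RHS]addrACA; congr (_ + _); exact: addrC.
    rewrite -[e]mulr1; apply: opnorm_leM symmetry_opnorm.
    apply: (opnorm_leW bound); apply: half; apply: opnorm_leD => //.
    exact: opnorm_leN.
have Db : D b.
  apply: (cstar_closed hD); first by apply: boundedZ; exact: boundedD.
  by move=> e /close[b' [c' [? ? ? ?]]]; exists b'.
have Dd : D (d \o U).
  apply: (cstar_closed hD); first exact: boundedM symmetry_bounded.
  by move=> e /close[b' [c' [? ? ? ?]]]; exists c'.
exists b, (d \o U); split=> //.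
have -> : d \o U \o U = d by apply/funext => x; rewrite /= symmetry_involutive.
by rewrite /b /d -scalerDr addrACA subrr addr0; exact: eq_half_of_double.
Qed.

Lemma cuntz_decomposition a : O a -> exists b c, [/\ D b, D c & a = b + (c \o U)].
Proof.
suff : O `<=` [set a | O a /\ exists b c, [/\ D b, D c & a = b + (c \o U)]].
  by move=> sub /sub[].
rewrite {1}/O -(cstar_generated_cuntz hS).
apply: smallest_sub; first exact: cstar_subalgebra_decomposition.
have DT : D (k *: T) := cstar_scale hD k (peval_closure_gen cuntz_family_TV true).
have DV : D (k *: V) := cstar_scale hD k (peval_closure_gen cuntz_family_TV false).
move=> _ [->|->]; split=> //; exists (k *: T).
  by exists (k *: V); split=> //; exact: generator_true_split.
exists (-1 *: (k *: V)); split=> //; first exact: (cstar_scale hD).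
by rewrite scaleN1r; exact: generator_false_split.
Qed.

Lemma fixed_points_eq : [set a | O a /\ sigma a = a] = D.
Proof.
apply/seteqP; split; last exact: cuntz_TV_fixed.
move=> a /= [Oa ea]; have [b [c [Db Dc e]]] := cuntz_decomposition Oa.
suff -> : a = b by [].
have s := flip_decomposition Db Dc; rewrite -e ea in s.
have aa : a + a = b + b by rewrite {1}e s addrACA subrr addr0.
by rewrite (eq_half_of_double aa) -(eq_half_of_double (erefl (b + b))).
Qed.

End flip.

End fixed_points.

End operators.

Theorem theorem1p4 (R : realType) (H : completeNormedModType R[i])
    (dot : {dot H for (@Num.conj R[i])}) (hH : hilbert_norm dot)
    (H_nonzero : exists x : H, x != 0)
    (S1 S2 : H -> H)
    (hS1 : isometry_operator dot S1) (hS2 : isometry_operator dot S2)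
    (hS : (S1 \o adjoint dot S1) + (S2 \o adjoint dot S2) = idfun) :
  let O2 := cstar_generated dot [set S1; S2] in
  forall (sigma : (H -> H) -> (H -> H)),
  star_automorphism dot O2 sigma ->
  (forall a, O2 a -> sigma (sigma a) = a) ->
  sigma S1 = S2 ->
  let T := (Num.sqrt (2 : R))^-1%:C *: (S1 + S2) in
  let U := (S1 \o adjoint dot S1) - (S2 \o adjoint dot S2) in
  let V := U \o T \o U in
  let fixed := [set a | O2 a /\ sigma a = a] in
  [/\ V = (Num.sqrt (2 : R))^-1%:C *: ((S1 - S2) \o U),
      fixed = cstar_generated dot [set T; V]
    & star_isomorphic dot fixed O2].
Proof.
pose S i := if i then S1 else S2.
pose S' i := adjoint dot (S i).
have isoS i : isometry_operator dot (S i) by case: i.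
have hSS' : cuntz_family dot S S'.
  apply: (cuntz_family_intro hH).
  - by move=> i; case: (isoS i) => -[].
  - by move=> i; exact: isometry_is_adjoint.
  - by move=> i x; case: (isoS i) => _ /(congr1 (fun f => f x)).
  - by move=> x; have := congr1 (fun f => f x) hS.
move=> O2 sigma hsigma sigma2 sigma1 T U V fixed.
have O2E : O2 = peval_closure S S' := cstar_generated_cuntz hH H_nonzero hSS'.
have sigmaS i : sigma (S i) = S (~~ i).
  case: i => //=; rewrite -[in LHS]sigma1; apply: sigma2.
  by rewrite O2E; exact: (peval_closure_gen hH hSS' true).
have hTV := cuntz_family_TV hH H_nonzero hSS'.
rewrite O2E in hsigma.
have fixedE := fixed_points_eq hH H_nonzero hSS' hsigma sigmaS.
split.
- exact: conj_symmetry_formula hSS'.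
- by rewrite /fixed O2E fixedE -(cstar_generated_cuntz hH H_nonzero hTV).
- by rewrite /fixed O2E fixedE; exact: peval_closure_isomorphic.
Qed.
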